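(* There exists a subgroup $G$ of a $\sigma$-compact subgroup of $\mathbb{Z}^{\mathbb{N}}$ (thus, $G$ is Hurewicz-bounded) such that $G$ does not have the Menger property.
   Context: The group $\mathbb{Z}^{\mathbb{N}}$ carries pointwise addition and the product topology ($\mathbb{Z}$ discrete); subgroups carry the subspace topology. $\sigma$-compact means a union of countably many compact sets. A topological group $(G,\cdot)$ is Hurewicz-bounded if for each sequence $(U_n)_{n\in\mathbb{N}}$ of neighborhoods of the unit there exist finite $F_n\subseteq G$ such that each $g\in G$ belongs to $F_n\cdot U_n=\{a\cdot u:a\in F_n,\ u\in U_n\}$ for all but finitely many $n$. A topological space $X$ has the Menger property if for each sequence $(\mathcal{U}_n)_{n\in\mathbb{N}}$ of open covers of $X$ there exist finite $\mathcal{F}_n\subseteq\mathcal{U}_n$, $n\in\mathbb{N}$, such that $\bigcup_n\mathcal{F}_n$ is a cover of $X$. *)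

(* Defs.v *)
From HB Require Import structures.
From mathcomp Require Import all_boot all_order all_algebra.
From mathcomp Require Import all_classical all_reals all_analysis.

Set Implicit Arguments.
Unset Strict Implicit.
Unset Printing Implicit Defensive.

Import GRing.Theory.
Local Open Scope classical_set_scope.
Local Open Scope ring_scope.

HB.instance Definition _ := GRing.Zmodule.copy (discrete_topology int) int.

Definition ZN : Type := {ptws nat -> discrete_topology int}.

HB.instance Definition _ := Topological.on ZN.
HB.instance Definition _ :=
  GRing.Zmodule.copy ZN (nat -> discrete_topology int).

Lemma ZN_cvg (F : set_system ZN) (f : ZN) : Filter F ->
  (forall i (A : set (discrete_topology int)),
     A (f i) -> F [set g : ZN | A (g i)]) ->
  F --> f.
Proof.
move=> FF H.
have [_ h] := @cvg_sup {ptws nat -> discrete_topology int} nat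
  (fun i => Topological.class
  (initial_topology (fun g : (nat -> discrete_topology int) => g i))) F f FF.
apply: h => i U.
have /= -> := @nbhsE
  (initial_topology (fun g : (nat -> discrete_topology int) => g i)) f.
move=> [B [[C oC <-] Cf] BU].
by apply: filterS BU _; apply: H.
Qed.

Lemma ZN_sub_continuous : continuous (fun x : ZN * ZN => x.1 - x.2).
Proof.
move=> x.
have /= := @ZN_cvg (fmap (fun y : ZN * ZN => y.1 - y.2) (nbhs x)) (x.1 - x.2)
  (fmap_filter _ (nbhs_filter x)).
apply => i A Ai.
have prj (a : ZN) : nbhs a [set f : ZN | f i = a i].
  have /= := @proj_continuous _ (fun _ : nat => discrete_topology int) i a.
  by move=> /(_ [set a i] (discrete_set1 _)).
exists ([set f : ZN | f i = x.1 i], [set f : ZN | f i = x.2 i]) => /=.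
  by split; exact: prj.
move=> [f g] [/= ef eg].
by have -> : (f - g) i = (x.1 - x.2) i by rewrite -[LHS]/(f i - g i) ef eg.
Qed.

HB.instance Definition _ :=
  PreTopologicalNmodule_isTopologicalZmodule.Build ZN ZN_sub_continuous.

(* [subspace G] would keep the whole carrier M, with the points outside G
   isolated: the covering properties need G itself as the space. *)
Definition subgroup_type (M : topologicalZmodType) (G : zmodClosed M) : Type :=
  {x : M | x \in G}.

Section SubgroupType.
Variables (M : topologicalZmodType) (G : zmodClosed M).

HB.instance Definition _ := SubChoice.on (subgroup_type G).
HB.instance Definition _ := [SubChoice_isSubZmodule of subgroup_type G by <:].
HB.instance Definition _ :=
  Topological.copy (subgroup_type G)
    (initial_topology (val : subgroup_type G -> M)).

Lemma subgroup_sub_continuous :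
  continuous (fun x : subgroup_type G * subgroup_type G => x.1 - x.2).
Proof.
apply: (@continuous_comp_initial _ _ _ (val : subgroup_type G -> M)) => x.
pose v (x : subgroup_type G * subgroup_type G) : M * M := (val x.1, val x.2).
apply: (@continuous_comp _ _ _ v (fun y => y.1 - y.2)).
  apply: cvg_pair; apply: continuous_comp; try exact: initial_continuous.
    exact: cvg_fst.
  exact: cvg_snd.
exact: sub_continuous.
Qed.

HB.instance Definition _ :=
  PreTopologicalNmodule_isTopologicalZmodule.Build (subgroup_type G)
    subgroup_sub_continuous.

End SubgroupType.

Definition sigma_compact (X : topologicalType) : Prop :=
  exists K : nat -> set X,
    (forall n, compact (K n)) /\ \bigcup_n K n = [set: X].

(* Only abelian groups are considered, written additively. *)
Definition Hurewicz_bounded (G : topologicalZmodType) : Prop :=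
  forall U : nat -> set G, (forall n, nbhs (0 : G) (U n)) ->
  exists F : nat -> set G, (forall n, finite_set (F n)) /\
    forall g : G, \forall n \near \oo,
      [set a + u | a in F n & u in U n] g.

Definition open_cover (X : topologicalType) (U : set (set X)) : Prop :=
  U `<=` open /\ \bigcup_(V in U) V = [set: X].

Definition Menger (X : topologicalType) : Prop :=
  forall U : nat -> set (set X), (forall n, open_cover (U n)) ->
  exists F : nat -> set (set X),
    (forall n, finite_set (F n) /\ F n `<=` U n) /\
    \bigcup_n \bigcup_(V in F n) V = [set: X].

(* Main.v *)
Require Import Defs.
From HB Require Import structures.
From mathcomp Require Import all_boot all_order all_algebra.
From mathcomp Require Import all_classical all_reals all_analysis.
From mathcomp Require Import finmap zify.

(** Let H be the group of bounded sequences; it is the union of the compact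
sets [-n,n]^N.  Index the coordinates by a point * and the pairs (n,a), and let
G be the group of bounded g such that g(n,a) = g( * ) for each n and all large
a.  The open sets V_(n,m) = {g : g(n,m) <> 0 or g( * ) <> 1}, m in N, cover G
for each n.  Given finitely many of them for each n, pick f(n) larger than all
the m involved: the element g of G with g( * ) = 1 and g(n,a) = [f(n) <= a] lies
in none of the chosen sets. *)

Set Implicit Arguments.
Unset Strict Implicit.
Unset Printing Implicit Defensive.

Import Order.TTheory GRing.Theory Num.Theory.
Local Open Scope classical_set_scope.
Local Open Scope ring_scope.

Section Subgroup.
Variables (M : topologicalZmodType) (G : zmodClosed M).

Lemma val_subgroup_continuous : continuous (val : subgroup_type G -> M).
Proof. exact: initial_continuous. Qed.

Lemma nbhs_subgroupP (x : subgroup_type G) (U : set (subgroup_type G)) :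
  nbhs x U <-> exists2 W, nbhs (val x) W & val @^-1` W `<=` U.
Proof.
split; last first.
  move=> [W Wx WU]; apply: filterS WU _.
  exact: val_subgroup_continuous.
rewrite nbhsE => -[B [[W oW <-] Wx] WU].
by exists W => //; exact: open_nbhs_nbhs.
Qed.

(** The image under [val] of a filter containing the trace of [K] clusters at a point of [K]; as [K]
    lies in [G], this point comes from the subgroup. *)
Lemma compact_subgroup (K : set M) :
  compact K -> K `<=` [set x | x \in G] ->
  compact (val @^-1` K : set (subgroup_type G)).
Proof.
move=> cK KG F PF FK.
have [|y [Ky yF]] := cK (val @ F); first exact: FK.
exists (exist _ y (KG _ Ky)); split => // A B FA /nbhs_subgroupP[W /= Wy WB].
have FA' : F (val @^-1` (val @` A)) by apply: filterS FA => x Ax; exists x.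
have [_ [[x Ax <-] Wx]] := yF _ _ FA' Wy.
by exists x; split => //; exact: WB.
Qed.

(** Finitely many open sets cover [K], each so small that two points of [G] in it differ by an
    element of [U]; one point of [G] per set then suffices. *)
Lemma compact_finite_translates (K : set M) (U : set (subgroup_type G)) :
  compact K -> nbhs (0 : subgroup_type G) U ->
  exists2 F : set (subgroup_type G), finite_set F &
    val @^-1` K `<=` [set a + u | a in F & u in U].
Proof.
move=> cK /nbhs_subgroupP[W W0 WU].
(* Subtraction is continuous at [(x, x)], where its value is 0. *)
have /choice[N NP] (x : M) : exists N : set M,
    nbhs x N /\ forall y z, N y -> N z -> W (y - z).
  have := @sub_continuous M (x, x) W; rewrite /= subrr.
  move=> /(_ W0)[[A B] /= [Ax Bx] ABW].
  exists (A `&` B); split; first exact: filterI.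
  by move=> y z [Ay _] [_ Bz]; exact: (ABW (y, z)).
pose pM : ptopologicalType := HB.pack (M : Type) M (isPointed.Build M 0).
have : cover_compact (K : set pM) by rewrite -compact_cover.
move=> /(_ M K (fun x => (N x)^°)) [x _|x Kx|D _ KD].
- exact: open_interior.
- by exists x => //; have [] := NP x.
(* The centres x need not lie in G; each is replaced by a point of G near it. *)
have /choice[r rP] (x : M) : exists a : subgroup_type G,
    forall g : subgroup_type G, N x (val g) -> N x (val a).
  have [[g Ng]|nN] := pselect (exists g : subgroup_type G, N x (val g)).
    by exists g.
  by exists 0 => g Ng; exfalso; apply: nN; exists g.
exists (r @` [set` D]); first exact/finite_image/finite_fset.
move=> g /KD[x /= xD /interior_subset Ng].
exists (r x); first by exists x.
exists (g - r x); last by rewrite addrC subrK.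
by apply: WU => /=; apply: (NP x).2 => //; exact: rP Ng.
Qed.

End Subgroup.

(** The finite set for [U n] serves the first n + 1 compact sets at once, so a point of the i-th one
    is caught for every n >= i. *)
Lemma sigma_compact_Hurewicz_bounded (M : topologicalZmodType)
    (H G : zmodClosed M) :
  sigma_compact (subgroup_type H) -> {subset G <= H} ->
  Hurewicz_bounded (subgroup_type G).
Proof.
move=> [K [cK KT]] GH U U0.
(* The trace of [K i] on [G] may fail to be compact, so the covers are taken in [M]. *)
have cvK i : compact (val @` K i : set M).
  apply: continuous_compact => //; apply: continuous_subspaceT.
  exact: val_subgroup_continuous.
have /choice[F FP] (ni : nat * nat) : exists F : set (subgroup_type G),
    finite_set F /\
    val @^-1` (val @` K ni.2) `<=` [set a + u | a in F & u in U ni.1].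
  by have [F fF KF] := compact_finite_translates (cvK ni.2) (U0 ni.1); exists F.
exists (fun n => \bigcup_(i < n.+1) F (n, i)); split.
  by move=> n; apply: bigcup_finite => // i _; exact: (FP (n, i)).1.
move=> g.
have [i _ Kg] : (\bigcup_n K n) (exist _ (val g) (GH _ (valP g))) by rewrite KT.
exists i => // n /= leqin.
have [|a Fa [u Uu <-]] := (FP (n, i)).2 g.
  by eexists; first exact: Kg.
by exists a; [exists i | exists u].
Qed.

Definition bounded_seq : {pred ZN} :=
  fun g => `[< exists b : nat, forall i, `|g i : int| <= b%:Z >].

Lemma bounded_seq_zmod : zmod_closed bounded_seq.
Proof.
split; first by apply/asboolP; exists 0%N => i.
move=> f g /asboolP[b fb] /asboolP[c gc]; apply/asboolP; exists (b + c)%N => i.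
rewrite PoszD; apply: le_trans (ler_normB (f i : int) (g i : int)) _.
exact: lerD.
Qed.

HB.instance Definition _ := GRing.isZmodClosed.Build ZN bounded_seq
  bounded_seq_zmod.

Lemma sigma_compact_bounded_seq : sigma_compact (subgroup_type bounded_seq).
Proof.
pose K (b : nat) : set ZN := [set g | forall i, `|g i : int| <= b%:Z].
have KH b : K b `<=` [set x | x \in bounded_seq].
  by move=> g Kg; apply/asboolP; exists b.
exists (fun b => val @^-1` K b); split; last first.
  by apply/seteqP; split => // -[g Hg] _; have /asboolP[b gb] := Hg; exists b.
move=> b; apply: compact_subgroup => //.
apply: (@tychonoff nat (fun=> discrete_topology int)
  (fun=> [set z : int | `|z| <= b%:Z])) => _.
apply: finite_compact.
(* The 2b + 1 integers from -b to b; [z] stands at index z + b. *)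
pose s : seq int := [seq j%:Z - b%:Z | j <- iota 0 (b + b).+1].
apply: sub_finite_set (finite_seq s) => z zb; apply/mapP.
have {}zb : `|z : int| <= b%:Z := zb.
by exists (absz (z + b%:Z)); rewrite ?mem_iota; lia.
Qed.

(* Coordinate 0 is the point *, coordinate (pickle (n, a)).+1 is (n, a). *)
Definition eventually_row_constant : {pred ZN} := fun g =>
  (g \in bounded_seq) &&
  `[< forall n : nat, \forall a \near \oo,
        g (choice.pickle (n, a)).+1 = g 0%N >].

Lemma eventually_row_constant_zmod : zmod_closed eventually_row_constant.
Proof.
split.
  apply/andP; split; first exact: rpred0.
  by apply/asboolP => n; near=> a.
move=> f g /andP[bf /asboolP fP] /andP[bg /asboolP gP].
apply/andP; split; first exact: rpredB.
apply/asboolP => n; near=> a.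
have -> (i : nat) : (f - g) i = f i - g i by [].
congr (_ - _); near: a; [exact: fP | exact: gP].
Unshelve. all: by end_near. Qed.

HB.instance Definition _ := GRing.isZmodClosed.Build ZN eventually_row_constant
  eventually_row_constant_zmod.

(** The point of [G] that escapes the chosen sets. Indices coding no pair get the default value
    0. *)
Definition epigraph (f : nat -> nat) : ZN := fun i =>
  if i is j.+1 then
    if choice.unpickle j is Some (n, a) then (f n <= a)%:R : int else 0
  else 1.

Lemma epigraphE (f : nat -> nat) (n a : nat) :
  epigraph f (choice.pickle (n, a)).+1 = (f n <= a)%:R :> int.
Proof. by rewrite /epigraph choice.pickleK. Qed.

(** All values are 0 or 1, and row [n] equals 1, the value at coordinate 0, from [a = f n] on. *)
Lemma epigraph_row_constant (f : nat -> nat) :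
  epigraph f \in eventually_row_constant.
Proof.
apply/andP; split.
  apply/asboolP; exists 1%N => -[//|j] /=.
  by case: choice.unpickle => [[n a]|//]; case: (_ <= _)%N.
apply/asboolP => n; near=> a; rewrite epigraphE.
suff -> : (f n <= a)%N by [].
by near: a; exists (f n).
Unshelve. all: by end_near. Qed.

Lemma open_coordinate (i : nat) (A : set int) : open [set g : ZN | A (g i)].
Proof.
have ci : continuous (fun g : ZN => g i : discrete_topology int).
  exact: (@proj_continuous nat (fun=> discrete_topology int)).
by apply: ((continuousP _).1 ci A); exact: discrete_open.
Qed.

Lemma not_Menger_row_constant : ~ Menger (subgroup_type eventually_row_constant).
Proof.
pose V (n m : nat) : set (subgroup_type eventually_row_constant) :=
  val @^-1` ([set g : ZN | g (choice.pickle (n, m)).+1 <> 0 :> int] `|`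
             [set g : ZN | g 0%N <> 1 :> int]).
have coverV n : open_cover (range (V n)).
  split.
    move=> _ [m _ <-].
    apply: ((continuousP _).1 (@val_subgroup_continuous _ _)).
    by apply: openU; [exact: (open_coordinate _ [set x | x <> 0]) |
      exact: (open_coordinate _ [set x | x <> 1])].
  apply/seteqP; split => // -[g Gg] _.
  (* At the threshold [m] of row [n] the value is that of coordinate 0: if it is 1, it is nonzero
     there. *)
  have /andP[_ /asboolP/(_ n)[m _ gm]] := Gg.
  exists (V n m); first by exists m.
  rewrite /V /= gm /=; last exact: leqnn.
  have [->|] := pselect (g 0%N = 1 :> int); first by left.
  by right.
move=> /(_ (fun n => range (V n)) coverV)[F [FP FT]].
have /choice[f fP] n : exists b,
    forall W, F n W -> exists2 m, W = V n m & (m < b)%N.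
  have [/finite_seqP[s Fs] FV] := FP n.
  (* Each chosen set gets an index; sets outside [F n] get the default 0. *)
  have /choice[m mP] W : exists m, F n W -> W = V n m.
    have [/FV[m _ <-]|nF] := pselect (F n W); first by exists m.
    by exists 0%N.
  exists (\max_(W <- s) m W).+1 => W FW; exists (m W); first exact: mP.
  rewrite ltnS; apply: leq_bigmax_seq => //.
  by move: FW; rewrite Fs.
have [n _ [W FW]] : (\bigcup_n \bigcup_(W in F n) W)
    (exist _ (epigraph f) (epigraph_row_constant f)) by rewrite FT.
have [m -> mf] := fP n W FW.
(* Coordinate 0 is 1, which leaves the first alternative; it fails because [m < f n] makes
   coordinate [(n, m)] vanish. *)
case=> [|//]; apply.
by rewrite [LHS]epigraphE leqNgt mf.
Qed.

Theorem theorem8p2 :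
  exists H G : zmodClosed ZN,
    [/\ sigma_compact (subgroup_type H),
        {subset G <= H},
        Hurewicz_bounded (subgroup_type G)
      & ~ Menger (subgroup_type G)].
Proof.
have GH : {subset eventually_row_constant <= bounded_seq}.
  by move=> g /andP[].
exists (bounded_seq : zmodClosed _), (eventually_row_constant : zmodClosed _).
split => //.
- exact: sigma_compact_bounded_seq.
- exact: sigma_compact_Hurewicz_bounded sigma_compact_bounded_seq GH.
- exact: not_Menger_row_constant.
Qed.
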